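(* Let $\beta>1$ and $\mu>0$, and let $(X_{(s,t)},\,0\le s\le t)$ and $X_t=X_{(0,t)}$ be the process described in the context. Then for every $x>0$, $$\mathbb{P}\left(\sup_{t>0}(X_t-\mu t)>x\right)=1-\exp\left(-\frac{1}{\mu(\beta-1)x^{\beta-1}}\right),$$ and for every $x>0$ and $t>0$, $$\mathbb{P}\left(\sup_{s\in[0,t]}\left(X_{(s,t)}-\mu(t-s)\right)>x\right)=1-\exp\left(-\frac{1}{\mu^{\beta}(\beta-1)}\left(\frac{1}{(x/\mu)^{\beta-1}}-\frac{1}{(x/\mu+t)^{\beta-1}}\right)\right).$$
   Context: $(X_{(s,t)},\,0\le s\le t)$ is a stochastic process with $X_{(t,t)}=0$ and the following properties: for $r<s<t$, $X_{(r,t)}=\max(X_{(r,s)},X_{(s,t)})$; $X_{(s,t)}$ and $X_{(u,v)}$ are independent if and only if the intervals $(s,t)$ and $(u,v)$ are disjoint (and variables attached to pairwise disjoint intervals are jointly independent); $X_{(s,t)}\overset{d}{=}X_{t-s}$, where $X_t=X_{(0,t)}$; and $\mathbb{P}(X_t\le x)=\exp(-t/x^{\beta})$ for $x>0$, $t>0$ (Fréchet marginals). Versions for which the processes $t\mapsto X_t$ and $t\mapsto\sup_{s\in[0,t]}(X_{(s,t)}-\mu(t-s))$ have cadlag paths are taken. *)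

(* Defs.v *)
From HB Require Import structures.
From mathcomp Require Import all_boot all_order all_algebra finmap.
From mathcomp Require Import all_classical all_reals all_analysis.

Set Implicit Arguments.
Unset Strict Implicit.
Unset Printing Implicit Defensive.

Import Order.TTheory GRing.Theory Num.Theory.
Import numFieldNormedType.Exports.

Local Open Scope classical_set_scope.
Local Open Scope ring_scope.

(* Paths are indexed by [0, +oo[; values at negative times are ignored. *)
Definition cadlag (R : realType) (f : R -> R) : Prop :=
  (forall t : R, 0 <= t -> f u @[u --> t^'+] --> f t) /\
  (forall t : R, 0 < t -> cvg (f u @[u --> t^'-])).

Section independence.
Context (d : measure_display) (T : measurableType d) (R : realType).
Variable P : probability T R.

Definition independent_pair (Y Z : {RV P >-> R}) : Prop :=
  forall A B : set R, measurable A -> measurable B ->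
    P (Y @^-1` A `&` Z @^-1` B) = (P (Y @^-1` A) * P (Z @^-1` B))%E.

Definition jointly_independent (I : choiceType) (Y : I -> {RV P >-> R}) : Prop :=
  forall (J : {fset I}) (A : I -> set R),
    (forall i, i \in J -> measurable (A i)) ->
    P (\bigcap_(i in [set` J]) (Y i @^-1` A i)) =
    (\prod_(i <- J) P (Y i @^-1` A i))%E.

End independence.

(* The process (X_(s,t), 0 <= s <= t) is a total function [X s t] of two reals,
   constrained only for 0 <= s <= t.  The first two properties hold for every
   sample point: the supremum over the uncountable family s in [0, t] would not
   be controlled by identities valid only almost surely for each fixed time. *)
Record frechet_max_process (d : measure_display) (T : measurableType d)
    (R : realType) (P : probability T R) (beta : R)
    (X : R -> R -> {RV P >-> R}) : Prop := FrechetMaxProcess {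
  fmp_diag : forall (t : R) (w : T), 0 <= t -> X t t w = 0 ;
  fmp_max : forall (r s t : R) (w : T), 0 <= r -> r < s -> s < t ->
    X r t w = Num.max (X r s w) (X s t w) ;
  fmp_indep_pair : forall s t u v : R, 0 <= s <= t -> 0 <= u <= v ->
    (independent_pair (X s t) (X u v) <->
     (`]s, t[ `&` `]u, v[)%classic = set0 :> set R) ;
  fmp_indep : forall (I : choiceType) (s t : I -> R),
    (forall i, 0 <= s i <= t i) ->
    trivIset setT (fun i => `]s i, t i[%classic : set R) ->
    jointly_independent (fun i => X (s i) (t i)) ;
  fmp_stationary : forall (s t : R) (A : set R), 0 <= s <= t -> measurable A ->
    distribution P (X s t) A = distribution P (X 0 (t - s)) A ;
  fmp_frechet : forall t x : R, 0 < t -> 0 < x ->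
    P [set w | X 0 t w <= x] = (expR (- (t / x `^ beta)))%:E
}.

Section suprema.
Context (d : measure_display) (T : measurableType d) (R : realType).
Context (P : probability T R).
Variables (X : R -> R -> {RV P >-> R}) (mu : R).

(* For a max-process the set below is nonempty and bounded above by
   max(X_(0,t), 0), so the real supremum is the genuine one. *)
Definition sup_upto (t : R) (w : T) : R :=
  sup [set X s t w - mu * (t - s) | s in `[0, t]%classic].

(* Extended-real valued: finiteness of the path supremum is not assumed. *)
Definition sup_all (w : T) : \bar R :=
  ereal_sup [set (X 0 t w - mu * t)%:E | t in `]0, +oo[%classic].

End suprema.

(* Main.v *)
Require Import Defs.
From HB Require Import structures.
From mathcomp Require Import all_boot all_order all_algebra finmap.
From mathcomp Require Import all_classical all_reals all_analysis.
From mathcomp Require Import ring lra.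

Set Implicit Arguments.
Unset Strict Implicit.
Unset Printing Implicit Defensive.

Import Order.TTheory GRing.Theory Num.Theory.
Import numFieldNormedType.Exports.
Local Open Scope classical_set_scope.
Local Open Scope ring_scope.

(** Both suprema exceed [x] exactly when a path [u |-> Y 0 u] crosses the line
    [u |-> x + mu * u].  For the first one [Y = X].  For the second one time is
    reversed from [t]: with [Y a b = X (t - b) (t - a)] one has
    [X s t = Y 0 (t - s)] ([sup_all_gt], [sup_upto_gt]).  Forward and reversed
    processes have the same three properties ([frechet_increments]), so a single
    computation on a finite horizon [t] serves both.

    Since [Y 0 u] is the maximum of the increments over a partition of [0, u]
    and the barrier increases, the path stays below the barrier at every point
    of a grid of mesh [delta] iff each increment [Y (i delta) ((i + 1) delta)]
    is at most the barrier at its own right endpoint ([grid_crossingC]).  These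
    increments are independent with Frechet laws, so this has probability
    [expR] of minus the Riemann sum of [u |-> (x + mu u)^(-beta)]
    ([prob_grid_crossing]).  Since [u |-> Y 0 u] is nondecreasing and the barrier
    is continuous, a crossing at any time forces a crossing at some dyadic grid
    point ([crossing_dyadic]).  Crossing events on the dyadic grids increase with
    the refinement, and continuity of the measure along them replaces the
    Riemann sum by the integral
    [(x^(1 - beta) - (x + mu t)^(1 - beta)) / (mu (beta - 1))]
    ([prob_crossing]).  The supremum over all [t > 0] follows by letting the
    horizon grow to infinity. *)

(** * Riemann sums of the barrier exponent *)

Section riemann_sum.
Context {R : realType}.
Implicit Types beta mu p q x t delta : R.

(** The middle term is the integral of [u |-> u^(-beta)] over [[p, q]]; the
    bounds come from the mean value theorem. *)
Lemma powR_secant_bounds beta p q : 1 < beta -> 0 < p -> p < q ->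
  (q - p) / q `^ beta <= (p `^ (1 - beta) - q `^ (1 - beta)) / (beta - 1)
    <= (q - p) / p `^ beta.
Proof.
move=> beta1 p0 pq.
have dP (z : R) : 0 < z ->
  is_derive z 1 (fun u : R => u `^ (1 - beta)) ((1 - beta) * z `^ (1 - beta - 1)).
  by move=> z0; exact: is_derive1_powR.
have [||c] := @MVT R (fun u : R => u `^ (1 - beta))
  (fun z : R => (1 - beta) * z `^ (1 - beta - 1)) p q pq.
- by move=> z; rewrite in_itv/= => /andP[pz _]; apply: dP; apply: lt_trans pz.
- apply: derivable_within_continuous => z; rewrite in_itv/= => /andP[pz _].
  by have [] := dP z (lt_le_trans p0 pz).
rewrite in_itv/= => /andP[pc cq] eqc.
have c0 : 0 < c by exact: lt_trans pc.
have -> : (p `^ (1 - beta) - q `^ (1 - beta)) / (beta - 1) = (q - p) / c `^ beta.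
  rewrite -opprB eqc (_ : 1 - beta - 1 = - beta); last by ring.
  rewrite powRN; field.
  by rewrite gt_eqF ?powR_gt0//= subr_eq0 gt_eqF.
have mono (a b : R) : 0 < a -> a < b -> (q - p) / b `^ beta <= (q - p) / a `^ beta.
  move=> a0 ab; rewrite ler_wpM2l ?subr_ge0 ?(ltW pq)// lef_pV2 ?posrE ?powR_gt0//.
    by rewrite ge0_ler_powR ?nnegrE ?ltW//; lra.
  exact: lt_trans ab.
by rewrite !mono.
Qed.

(** The integral of [u |-> (x + mu u)^(-beta)] over [[0, t]], in closed form. *)
Definition barrier_exponent beta mu x t : R :=
  (x `^ (1 - beta) - (x + mu * t) `^ (1 - beta)) / (mu * (beta - 1)).

(** The right-endpoint Riemann sum of [u |-> (x + mu u)^(-beta)] over [N] cells of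
    length [delta]. *)
Definition barrier_sum beta mu x delta (N : nat) : R :=
  \sum_(i < N) delta / (x + mu * (i.+1%:R * delta)) `^ beta.

Lemma barrier_sum_bounds beta mu x delta N :
    1 < beta -> 0 < mu -> 0 < x -> 0 < delta ->
  barrier_exponent beta mu x (N%:R * delta) - delta / x `^ beta
    <= barrier_sum beta mu x delta N
    <= barrier_exponent beta mu x (N%:R * delta).
Proof.
move=> beta1 mu0 x0 delta0.
have beta0 : 0 < beta - 1 by rewrite subr_gt0.
pose level k := x + mu * (k%:R * delta).
have level0 k : 0 < level k.
  by rewrite ltr_pwDl// !mulr_ge0// ltW.
have step k : delta / level k.+1 `^ beta <=
    barrier_exponent beta mu x (k.+1%:R * delta) -
    barrier_exponent beta mu x (k%:R * delta) <= delta / level k `^ beta.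
  have levelB : level k.+1 - level k = mu * delta.
    by rewrite /level -addn1 natrD; ring.
  have lt_level : level k < level k.+1.
    by rewrite -subr_gt0 levelB mulr_gt0.
  have := powR_secant_bounds beta1 (level0 k) lt_level.
  rewrite levelB -!mulrA -(ler_pM2l (x := mu^-1)) ?invr_gt0//.
  rewrite mulKf ?gt_eqF// => /andP[lo hi].
  have -> : barrier_exponent beta mu x (k.+1%:R * delta) -
            barrier_exponent beta mu x (k%:R * delta) =
            mu^-1 * ((level k `^ (1 - beta) - level k.+1 `^ (1 - beta)) / (beta - 1)).
    rewrite /barrier_exponent -!/(level _); field.
    by rewrite !gt_eqF.
  by rewrite lo/= -(ler_pM2l mu0) mulrA mulfV ?gt_eqF// mul1r.
(* The left-endpoint sum exceeds the right-endpoint one by the difference of the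
   first and last terms. *)
have lower n : barrier_exponent beta mu x (n%:R * delta) +
    delta / level n `^ beta - delta / x `^ beta <= barrier_sum beta mu x delta n.
  elim: n => [|n IH].
    rewrite /barrier_sum big_ord0 /barrier_exponent /level mul0r mulr0 addr0.
    by rewrite subrr mul0r add0r subrr.
  rewrite /barrier_sum big_ord_recr/= -/(barrier_sum _ _ _ _ _) -/(level n.+1).
  by have := step n; lra.
have upper n : barrier_sum beta mu x delta n <=
    barrier_exponent beta mu x (n%:R * delta).
  elim: n => [|n IH].
    rewrite /barrier_sum big_ord0 /barrier_exponent mul0r mulr0 addr0.
    by rewrite subrr mul0r.
  rewrite /barrier_sum big_ord_recr/= -/(barrier_sum _ _ _ _ _) -/(level n.+1).
  by have := step n; lra.
rewrite upper andbT; apply: le_trans (lower N).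
by rewrite lerD2r lerDl divr_ge0 ?powR_ge0// ltW.
Qed.

Lemma pow2_gt0 n : 0 < 2 ^+ n :> R. Proof. by rewrite exprn_gt0. Qed.

Lemma cvg_dyadic_mesh t : t / 2 ^+ n @[n --> \oo] --> 0.
Proof.
rewrite (_ : (fun n => _) = geometric t (2^-1)); last first.
  by apply/funext => n; rewrite /= exprVn.
apply: cvg_geometric; rewrite ger0_norm ?invr_ge0//.
by rewrite invf_lt1// ltr1n.
Qed.

Lemma cvg_barrier_sum beta mu x t : 1 < beta -> 0 < mu -> 0 < x -> 0 < t ->
  barrier_sum beta mu x (t / 2 ^+ n) (2 ^ n) @[n --> \oo] -->
  barrier_exponent beta mu x t.
Proof.
move=> beta1 mu0 x0 t0.
have tE n : (2 ^ n)%:R * (t / 2 ^+ n) = t.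
  by rewrite natrX mulrC divfK ?gt_eqF ?pow2_gt0.
apply: (@squeeze_cvgr _ _ _ _
  (fun n => barrier_exponent beta mu x t - (t / 2 ^+ n) / x `^ beta)
  (fun=> barrier_exponent beta mu x t)).
- near=> n.
  by have := barrier_sum_bounds (2 ^ n) beta1 mu0 x0
    (divr_gt0 t0 (pow2_gt0 n)); rewrite tE.
- rewrite -[X in _ --> X]subr0 -[X in _ --> _ - X](mul0r (x `^ beta)^-1).
  apply: cvgB; first exact: cvg_cst.
  by apply: cvgMl; exact: cvg_dyadic_mesh.
- exact: cvg_cst.
Unshelve. all: by end_near. Qed.

Lemma cvg_barrier_exponent beta mu x : 1 < beta -> 0 < mu -> 0 < x ->
  barrier_exponent beta mu x n.+1%:R @[n --> \oo] -->
  x `^ (1 - beta) / (mu * (beta - 1)).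
Proof.
move=> beta1 mu0 x0; rewrite /barrier_exponent.
apply: cvgMl; rewrite -[X in _ --> X]subr0.
apply: cvgB; first exact: cvg_cst.
rewrite (_ : (fun n => _) =
    (fun u : R => u `^ (beta - 1)) \o (fun n : nat => (x + mu * n.+1%:R)^-1)); last first.
  apply/funext => n /=; rewrite -powR_inv1 ?addr_ge0 ?mulr_ge0 ?ltW//.
  by rewrite -powRrM; congr powR; ring.
have h n : 0 < x + mu * n.+1%:R by rewrite ltr_pwDl// mulr_ge0// ltW.
have beta0 : 0 < beta - 1 by rewrite subr_gt0.
have /cvg_at_rightP := powR_cvg0 beta0.
apply; split=> [n|]; first by rewrite invr_gt0.
apply/gtr0_cvgV0; first by apply: nearW => n; exact: h.
apply/cvgryPge => A; near=> n.
have : (A / mu) <= n%:R by near: n; exact: nbhs_infty_ger.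
rewrite ler_pdivrMr// => An; apply: (le_trans An).
by rewrite -natr1 mulrDr mulr1 [n%:R * mu]mulrC; lra.
Unshelve. all: by end_near. Qed.

End riemann_sum.

(** * The forward process and its time reversal *)

(** The properties of the max-process used below, restricted to the intervals
    [[a, b]] contained in [[0, t]]; unlike [frechet_max_process] they are
    invariant under the reversal [u |-> t - u]. *)
Record frechet_increments (d : measure_display) (T : measurableType d)
    (R : realType) (P : probability T R) (beta t : R)
    (Y : R -> R -> {RV P >-> R}) : Prop := FrechetIncrements {
  fi_max : forall (a b c : R) (w : T), 0 <= a -> a < b -> b < c -> c <= t ->
    Y a c w = Num.max (Y a b w) (Y b c w) ;
  fi_cdf : forall a b y : R, 0 <= a -> a < b -> b <= t -> 0 < y ->
    P [set w | Y a b w <= y] = (expR (- ((b - a) / y `^ beta)))%:E ;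
  fi_indep : forall (I : choiceType) (a b : I -> R),
    (forall i, [/\ 0 <= a i, a i <= b i & b i <= t]) ->
    trivIset setT (fun i => `]a i, b i[%classic : set R) ->
    jointly_independent (fun i => Y (a i) (b i))
}.

Section increments_of_process.
Context (d : measure_display) (T : measurableType d) (R : realType).
Context (P : probability T R) (beta : R) (X : R -> R -> {RV P >-> R}).
Hypothesis X_process : frechet_max_process beta X.

Lemma frechet_max_process_cdf s t y : 0 <= s -> s < t -> 0 < y ->
  P [set w | X s t w <= y] = (expR (- ((t - s) / y `^ beta)))%:E.
Proof.
move=> s0 st y0; rewrite -(fmp_frechet X_process) ?subr_gt0//.
have mA : measurable (`]-oo, y]%classic : set R) by exact: measurable_itv.
have := fmp_stationary X_process (s := s) (t := t).
move=> /(_ _ _ mA); rewrite s0 (ltW st) => /(_ isT).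
rewrite /distribution /pushforward/=.
by congr (P _ = P _); apply/seteqP; split=> w /=; rewrite in_itv.
Qed.

Lemma increments_forward t : frechet_increments beta t X.
Proof.
split=> [a b c w a0 ab bc _|a b y a0 ab _ y0|I a b abt triv].
- exact: (fmp_max X_process).
- exact: frechet_max_process_cdf.
- by apply: (fmp_indep X_process) => // i; have [-> ->] := abt i.
Qed.

Lemma increments_reversed t :
  frechet_increments beta t (fun a b => X (t - b) (t - a)).
Proof.
split=> [a b c w a0 ab bc ct|a b y a0 ab bt y0|I a b abt triv].
- rewrite maxC; apply: (fmp_max X_process); lra.
- rewrite frechet_max_process_cdf//; [|lra|lra].
  by rewrite (_ : t - a - (t - b) = b - a)//; ring.
- apply: (fmp_indep X_process) => [i|].
    by have [a0 ab bt] := abt i; apply/andP; split; lra.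
  move=> i j _ _ [z [/= zi zj]]; apply: triv => //.
  exists (t - z); move: zi zj; rewrite /= !in_itv/=.
  by move=> /andP[? ?] /andP[? ?]; split; apply/andP; split; lra.
Qed.

End increments_of_process.

(** * Crossing a linear barrier on a finite horizon *)

Section linear_barrier.
Context (d : measure_display) (T : measurableType d) (R : realType).
Context (P : probability T R) (beta mu x : R).
Hypotheses (beta_gt1 : 1 < beta) (mu_gt0 : 0 < mu) (x_gt0 : 0 < x).
Implicit Types (Y : R -> R -> {RV P >-> R}) (t delta : R).

(** The path [u |-> Y 0 u] exceeds the barrier [x + mu * u] somewhere on
    []0, t]]. *)
Definition crossing Y t : set T :=
  [set w | exists2 u, 0 < u <= t & x + mu * u < Y 0 u w].

(** The path exceeds the barrier at one of the grid points [delta], ...,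
    [N * delta]; the index [k] is shifted by one, [k.+1%:R * delta]. *)
Definition grid_crossing Y delta (N : nat) : set T :=
  [set w | exists2 k, (k < N)%N &
     x + mu * (k.+1%:R * delta) < Y 0 (k.+1%:R * delta) w].

Lemma measurable_superlevel Y a b c : measurable [set w | c < Y a b w].
Proof.
rewrite (_ : [set w | _] = Y a b @^-1` `]c, +oo[%classic).
  by rewrite -[X in measurable X]setTI; apply: measurable_funPT.
by apply/seteqP; split=> w /=; rewrite in_itv/= andbT.
Qed.

Lemma measurable_grid_crossing Y delta N : measurable (grid_crossing Y delta N).
Proof.
rewrite (_ : grid_crossing _ _ _ = \bigcup_(k in `I_N)
    [set w | x + mu * (k.+1%:R * delta) < Y 0 (k.+1%:R * delta) w]).
  by apply: bigcup_measurable => k _; exact: measurable_superlevel.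
by apply/seteqP; split=> w [k ? ?]; exists k.
Qed.

Lemma grid_max_le Y t delta k y w : frechet_increments beta t Y ->
  0 < delta -> k.+1%:R * delta <= t ->
  Y 0 (k.+1%:R * delta) w <= y <->
  forall i, (i <= k)%N -> Y (i%:R * delta) (i.+1%:R * delta) w <= y.
Proof.
move=> HY delta0; elim: k => [|k IH] kt.
  split=> [Yy i|/(_ 0%N isT)]; last by rewrite mul0r.
  by rewrite leqn0 => /eqP->; rewrite mul0r.
have lt_grid i : i%:R * delta < i.+1%:R * delta.
  by rewrite ltr_pM2r// ltr_nat.
have kt' : k.+1%:R * delta <= t by exact: le_trans (ltW (lt_grid _)) kt.
rewrite (fi_max HY (b := k.+1%:R * delta)) ?mulr_gt0// ge_max.
split=> [/andP[/(IH kt') Yk Yk1] i|Yy].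
  by rewrite leq_eqVlt => /predU1P[->//|]; exact: Yk.
by rewrite Yy// andbT; apply/(IH kt') => i ik; apply: Yy; exact: leqW.
Qed.

(** A bound on [Y 0 ((k + 1) delta)] bounds all the increments up to there, but
    the bound required of the [i]-th increment is tightest at its own right
    endpoint, because the barrier increases. *)
Lemma grid_crossingC Y t delta N : frechet_increments beta t Y ->
  0 < delta -> N%:R * delta <= t ->
  ~` grid_crossing Y delta N = [set w | forall i, (i < N)%N ->
    Y (i%:R * delta) (i.+1%:R * delta) w <= x + mu * (i.+1%:R * delta)].
Proof.
move=> HY delta0 Nt.
have kt k : (k < N)%N -> k.+1%:R * delta <= t.
  by move=> kN; apply: le_trans Nt; rewrite ler_pM2r// ler_nat.
apply/seteqP; split=> w /=.
  move=> nocross i iN; apply: (iffLR (grid_max_le _ _ HY delta0 (kt _ iN))) => //.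
  by rewrite leNgt; apply/negP => cross; apply: nocross; exists i.
move=> below [k kN]; apply/negP; rewrite -leNgt.
apply/(grid_max_le _ _ HY delta0 (kt _ kN)) => i ik.
apply: le_trans (below i (leq_ltn_trans ik kN)) _.
by rewrite lerD2l ler_pM2l// ler_pM2r// ler_nat.
Qed.

Lemma prob_grid_crossing Y t delta N : frechet_increments beta t Y ->
  0 < delta -> N%:R * delta <= t ->
  P (grid_crossing Y delta N) = (1 - expR (- barrier_sum beta mu x delta N))%:E.
Proof.
move=> HY delta0 Nt; rewrite -[grid_crossing _ _ _]setCK probability_setC; last first.
  by apply: measurableC; exact: measurable_grid_crossing.
rewrite EFinB; congr (_ - _)%E.
rewrite (grid_crossingC HY delta0 Nt).
pose a (i : 'I_N) := i%:R * delta.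
pose b (i : 'I_N) := i.+1%:R * delta.
pose A (i : 'I_N) : set R := `]-oo, x + mu * b i]%classic.
have ab i : a i < b i by rewrite ltr_pM2r// ltr_nat.
have a0 i : 0 <= a i by rewrite mulr_ge0// ltW.
have bt i : b i <= t.
  by apply: le_trans Nt; rewrite ler_pM2r// ler_nat.
have triv : trivIset setT (fun i => `]a i, b i[%classic : set R).
  move=> i j _ _ [z [/=]]; rewrite !in_itv/= => /andP[az zb] /andP[az' zb'].
  have := lt_trans az zb'; have := lt_trans az' zb.
  rewrite !ltr_pM2r// !ltr_nat !ltnS => ji ij.
  by apply/val_inj/eqP; rewrite eqn_leq ij ji.
have indep := fi_indep HY (a := a) (b := b)
  (fun i => And3 (a0 i) (ltW (ab i)) (bt i)) triv.
pose J : {fset 'I_N} := [fset i in enum 'I_N]%fset.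
have memJ i : i \in J by rewrite inE/= mem_enum.
have := indep J A (fun i _ => measurable_itv _).
have -> : \bigcap_(i in [set` J]) (Y (a i) (b i) @^-1` A i) =
    [set w | forall i, (i < N)%N ->
      Y (i%:R * delta) (i.+1%:R * delta) w <= x + mu * (i.+1%:R * delta)].
  apply/seteqP; split=> w /= h i.
    by move=> iN; have := h (Ordinal iN) (memJ _); rewrite /A /= in_itv.
  by move=> _; rewrite /A /= in_itv/=; exact: h.
move=> ->; rewrite /barrier_sum -sumrN expR_sum -prodEFin.
have perm : perm_eq (J : seq _) (index_enum 'I_N).
  apply: uniq_perm; [exact: fset_uniq|exact: index_enum_uniq|].
  by move=> i; rewrite memJ mem_index_enum.
rewrite (perm_big _ perm)/=; apply: eq_bigr => i _.
rewrite (_ : _ @^-1` _ = [set w | Y (a i) (b i) w <= x + mu * b i]); last first.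
  by apply/seteqP; split=> w; rewrite /A /= in_itv.
rewrite (fi_cdf HY)// ?ltr_pwDl ?mulr_ge0 ?(ltW mu_gt0) ?(ltW delta0)//.
by rewrite (_ : b i - a i = delta)// /a /b -natr1; ring.
Qed.

(** If the path exceeds the barrier at [u] by [gap], then by monotonicity it still
    does at the next grid point, as soon as the barrier grows by less than
    [gap] over one cell. *)
Lemma crossing_dyadic Y t : frechet_increments beta t Y -> 0 < t ->
  crossing Y t = \bigcup_n grid_crossing Y (t / 2 ^+ n) (2 ^ n).
Proof.
move=> HY t0; have delta0 n : 0 < t / 2 ^+ n by rewrite divr_gt0// pow2_gt0.
have tE n : (2 ^ n)%:R * (t / 2 ^+ n) = t.
  by rewrite natrX mulrC divfK// gt_eqF// pow2_gt0.
apply/seteqP; split=> w; last first.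
  move=> [n _ [k kN cross]]; exists (k.+1%:R * (t / 2 ^+ n)) => //.
  by rewrite mulr_gt0//= -[leRHS](tE n) ler_pM2r// ler_nat.
move=> [u /andP[u0 ut] cross].
pose gap := Y 0 u w - (x + mu * u).
have gap0 : 0 < gap by rewrite subr_gt0.
have [n small] : exists n, mu * (t / 2 ^+ n) < gap.
  have mesh0 : t / 2 ^+ n @[n --> \oo] --> 0 by exact: cvg_dyadic_mesh.
  have : \forall n \near \oo, t / 2 ^+ n < gap / mu.
    by apply: (cvgr_lt 0 mesh0); rewrite divr_gt0.
  by move=> [n _ /(_ n (leqnn n))/=]; exists n; rewrite mulrC -ltr_pdivlMr.
set delta := t / 2 ^+ n in small.
have exk : exists k, u <= k%:R * delta by exists (2 ^ n)%N; rewrite tE.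
(* The least grid point to the right of [u]. *)
case: (ex_minnP exk) => -[|k] uk mink.
  by move: uk; rewrite mul0r leNgt u0.
have ku : k%:R * delta < u.
  by rewrite ltNge; apply/negP => /mink; rewrite ltnn.
have kN : (k < 2 ^ n)%N by apply: mink; rewrite tE.
exists n => //; exists k => //; rewrite -/delta.
have vt : k.+1%:R * delta <= t.
  by rewrite -(tE n) ler_pM2r ?(delta0 n)// ler_nat.
have mono : Y 0 u w <= Y 0 (k.+1%:R * delta) w.
  move: uk; rewrite le_eqVlt => /predU1P[->//|uk].
  by rewrite (fi_max HY (b := u) (c := _ * _))// le_max lexx.
have vu : k.+1%:R * delta <= u + delta by rewrite -natr1 mulrDl mul1r; lra.
have : mu * (k.+1%:R * delta) <= mu * u + mu * delta.
  by rewrite -mulrDr ler_pM2l.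
rewrite /gap in small; lra.
Qed.

Lemma measurable_crossing Y t : frechet_increments beta t Y -> 0 < t ->
  measurable (crossing Y t).
Proof.
move=> HY t0; rewrite (crossing_dyadic HY t0); apply: bigcupT_measurable => n.
exact: measurable_grid_crossing.
Qed.

Lemma prob_crossing Y t : frechet_increments beta t Y -> 0 < t ->
  P (crossing Y t) = (1 - expR (- barrier_exponent beta mu x t))%:E.
Proof.
move=> HY t0; pose A n := grid_crossing Y (t / 2 ^+ n) (2 ^ n).
have mA n : measurable (A n) by exact: measurable_grid_crossing.
have ndA : nondecreasing_seq A.
  apply/nondecreasing_seqP => n; rewrite subsetEset => w [k kN cross].
  have gridE : k.*2.+2%:R * (t / 2 ^+ n.+1) = k.+1%:R * (t / 2 ^+ n) :> R.
    rewrite -doubleS -muln2 natrM exprS; field.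
    by rewrite gt_eqF ?pow2_gt0.
  (* The point of rank [k + 1] has rank [2 (k + 1)] on the refined grid. *)
  exists k.*2.+1; last by rewrite gridE.
  by rewrite expnS mul2n -doubleS leq_double.
have cvgP : P (A n) @[n --> \oo] --> P (crossing Y t).
  rewrite (crossing_dyadic HY t0); apply: nondecreasing_cvg_mu => //.
  exact: bigcupT_measurable.
apply: (cvg_unique _ cvgP) => //.
rewrite (_ : (fun n => _) =
    EFin \o fun n => 1 - expR (- barrier_sum beta mu x (t / 2 ^+ n) (2 ^ n))).
  apply: cvg_EFin; first exact: nearW.
  apply: cvgB; first exact: cvg_cst.
  apply: continuous_cvg; first exact: continuous_expR.
  by apply: cvgN; exact: cvg_barrier_sum.
apply/funext => n /=; rewrite (prob_grid_crossing HY) ?divr_gt0 ?pow2_gt0//.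
by rewrite natrX mulrC divfK// gt_eqF// pow2_gt0.
Qed.

End linear_barrier.

(** * The suprema as crossing events *)

Section suprema_crossings.
Context (d : measure_display) (T : measurableType d) (R : realType).
Context (P : probability T R) (beta mu : R) (X : R -> R -> {RV P >-> R}).
Hypothesis X_process : frechet_max_process beta X.
Hypothesis mu_gt0 : 0 < mu.

Lemma sup_all_gt x :
  [set w | (x%:E < sup_all X mu w)%E] = \bigcup_n crossing mu x X n.+1%:R.
Proof.
apply/seteqP; split=> w /=.
  move=> /ereal_sup_gt[y [u]]; rewrite /= in_itv/= andbT => u0 <-.
  rewrite lte_fin ltrBrDr => cross; exists (Num.truncn u) => //.
  by exists u; rewrite // u0/= ltW// truncnS_gt.
move=> [n _ [u /andP[u0 _] cross]].
apply: (@lt_le_trans _ _ (X 0 u w - mu * u)%:E).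
  by rewrite lte_fin ltrBrDr.
by apply: ereal_sup_ubound; exists u => //=; rewrite in_itv/= u0.
Qed.

Lemma sup_upto_gt x t : 0 < x -> 0 < t ->
  [set w | x < sup_upto X mu t w] =
  crossing mu x (fun a b => X (t - b) (t - a)) t.
Proof.
move=> x0 t0; apply/seteqP; split=> w; rewrite /crossing /sup_upto /= subr0.
  move=> /sup_gt[|y [s]].
    by exists (X t t w - mu * (t - t)), t => //=; rewrite in_itv/= lexx ltW.
  rewrite /= in_itv/= => /andP[s0 st] <-; rewrite ltrBrDr => cross.
  move: st; rewrite le_eqVlt => /predU1P[st|st].
    (* At [s = t] the process vanishes, which is below the barrier. *)
    by move: cross; rewrite st (fmp_diag X_process _ (ltW t0)) subrr; lra.
  by exists (t - s); rewrite ?subKr// subr_gt0 st gerBl.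
move=> [u /andP[u0 ut] cross].
apply: (@lt_le_trans _ _ (X (t - u) t w - mu * (t - (t - u)))).
  by rewrite subKr ltrBrDr.
apply: ub_le_sup; last first.
  by exists (t - u) => //=; rewrite in_itv/= subr_ge0 ut gerBl ltW.
(* The set is bounded, so that [sup] is a genuine supremum: [X s t <= X 0 t] for
   [s < t], and the value at [s = t] is zero. *)
exists (Num.max (X 0 t w) 0) => y [s /=]; rewrite in_itv/= => /andP[s0 st] <-.
have drift : 0 <= mu * (t - s) by rewrite mulr_ge0 ?subr_ge0// ltW.
rewrite le_max; move: st; rewrite le_eqVlt => /predU1P[st|st].
  by rewrite st (fmp_diag X_process _ (ltW t0)) subrr mulr0 subr0 lexx orbT.
apply/orP; left; apply: (@le_trans _ _ (X s t w)); first by rewrite gerBl.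
move: s0; rewrite le_eqVlt => /predU1P[<-//|s0].
by rewrite [X in _ <= X](fmp_max X_process (s := s))// le_max lexx orbT.
Qed.

End suprema_crossings.

Lemma barrier_exponent_scaled (R : realType) (beta mu x t : R) :
    0 < mu -> 0 < x -> 0 <= t -> 1 < beta ->
  barrier_exponent beta mu x t =
  1 / (mu `^ beta * (beta - 1)) *
    (1 / (x / mu) `^ (beta - 1) - 1 / (x / mu + t) `^ (beta - 1)).
Proof.
move=> mu0 x0 t0 beta1; rewrite /barrier_exponent.
have xt0 : 0 < x + mu * t by rewrite ltr_pwDl// mulr_ge0// ltW.
(* Factor [mu] out of both bases, using [x / mu + t = (x + mu t) / mu]. *)
rewrite (_ : x / mu + t = (x + mu * t) / mu); last by field; rewrite gt_eqF.
rewrite !powRM ?invr_ge0 ?ltW// (_ : 1 - beta = - (beta - 1)); last by ring.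
have -> : mu^-1 `^ (beta - 1) = (mu `^ (beta - 1))^-1.
  by rewrite -powR_inv1 ?ltW// -powRrM mulN1r powRN.
rewrite !powRN -(mulr_powRB1 (ltW mu0) (lt_trans ltr01 beta1)); field.
by rewrite subr_eq0 !gt_eqF ?powR_gt0.
Qed.

(** * The two crossing probabilities *)

Theorem proposition1 (d : measure_display) (T : measurableType d)
    (R : realType) (P : probability T R) (beta mu : R)
    (X : R -> R -> {RV P >-> R})
    (beta_gt1 : 1 < beta) (mu_gt0 : 0 < mu)
    (X_process : frechet_max_process beta X)
    (X_cadlag : forall w : T, cadlag (fun t : R => X 0 t w))
    (sup_cadlag : forall w : T, cadlag (fun t : R => sup_upto X mu t w)) :
  (forall x : R, 0 < x ->
     P [set w | (x%:E < sup_all X mu w)%E] =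
     (1 - expR (- (1 / (mu * (beta - 1) * x `^ (beta - 1)))))%:E) /\
  (forall x t : R, 0 < x -> 0 < t ->
     P [set w | x < sup_upto X mu t w] =
     (1 - expR (- (1 / (mu `^ beta * (beta - 1)) *
                   (1 / (x / mu) `^ (beta - 1) -
                    1 / (x / mu + t) `^ (beta - 1)))))%:E).
Proof.
split=> [x x0|x t x0 t0]; last first.
  rewrite (sup_upto_gt X_process mu_gt0 x0 t0).
  rewrite (prob_crossing beta_gt1 mu_gt0 x0 (increments_reversed X_process t) t0).
  by rewrite barrier_exponent_scaled// ltW.
(* The event is the increasing union of the crossing events on [0, n + 1]. *)
rewrite sup_all_gt.
have fwd t := increments_forward X_process t.
have mA (n : nat) : measurable (crossing mu x X n.+1%:R).
  exact: measurable_crossing (fwd _) _.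
have ndA : nondecreasing_seq (fun n : nat => crossing mu x X n.+1%:R).
  move=> m n mn; rewrite subsetEset => w [u /andP[u0 um] cross].
  by exists u; rewrite // u0 (le_trans um)// ler_nat.
have cvgP : P (crossing mu x X n.+1%:R) @[n --> \oo] -->
    P (\bigcup_n crossing mu x X n.+1%:R).
  by apply: nondecreasing_cvg_mu => //; exact: bigcupT_measurable.
apply: (cvg_unique _ cvgP) => //.
rewrite (_ : (fun n => _) =
    EFin \o fun n : nat => 1 - expR (- barrier_exponent beta mu x n.+1%:R)); last first.
  by apply/funext => n /=; rewrite (prob_crossing beta_gt1 mu_gt0 x0 (fwd _)).
apply: cvg_EFin; first exact: nearW.
apply: cvgB; first exact: cvg_cst.
apply: continuous_cvg; first exact: continuous_expR.
apply: cvgN; rewrite (_ : 1 / _ = x `^ (1 - beta) / (mu * (beta - 1))).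
  exact: cvg_barrier_exponent.
rewrite (_ : 1 - beta = - (beta - 1)); last by ring.
by rewrite powRN div1r invfM mulrC.
Qed.
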